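(* Let $(X,\mathcal{E})$ be a ballean and let $\mathbb{V}(X)$ be the vector space over $\mathbb{R}$ with basis $X$. Then there exists a unique vector ideal $\mathcal{I}_{(X,\mathcal{E})}$ on $\mathbb{V}(X)$ such that both of the following hold: (i) $(X,\mathcal{E})$ is a subballean of $(\mathbb{V}(X),\mathcal{I}_{(X,\mathcal{E})})$; (ii) for every vector ballean $(\mathcal{V},\mathcal{I})$, every coarse mapping $f:(X,\mathcal{E})\to(\mathcal{V},\mathcal{I})$ extends to a unique coarse linear mapping $(\mathbb{V}(X),\mathcal{I}_{(X,\mathcal{E})})\to(\mathcal{V},\mathcal{I})$.
   Context: A coarse structure on a set $X$ is a family $\mathcal{E}$ of subsets of $X\times X$ such that: each $\varepsilon\in\mathcal{E}$ contains the diagonal $\Delta_X=\{(x,x):x\in X\}$; if $\varepsilon,\delta\in\mathcal{E}$ then $\varepsilon\circ\delta=\{(x,y):\exists z\,((x,z)\in\varepsilon,\ (z,y)\in\delta)\}\in\mathcal{E}$ and $\varepsilon^{-1}=\{(y,x):(x,y)\in\varepsilon\}\in\mathcal{E}$; if $\varepsilon\in\mathcal{E}$ and $\Delta_X\subseteq\varepsilon'\subseteq\varepsilon$ then $\varepsilon'\in\mathcal{E}$; for any $x,y\in X$ there is $\varepsilon\in\mathcal{E}$ with $(x,y)\in\varepsilon$. The pair $(X,\mathcal{E})$ is called a ballean. Write $\varepsilon[x]=\{y\in X:(x,y)\in\varepsilon\}$. A mapping $f:(X,\mathcal{E})\to(X',\mathcal{E}')$ between balleans is coarse if for every $\varepsilon\in\mathcal{E}$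 there is $\varepsilon'\in\mathcal{E}'$ such that $f(\varepsilon[x])\subseteq\varepsilon'[f(x)]$ for every $x\in X$. For $Y\subseteq X$, the subballean on $Y$ is $(Y,\mathcal{E}_Y)$ with $\mathcal{E}_Y=\{\varepsilon\cap(Y\times Y):\varepsilon\in\mathcal{E}\}$. ''$(X,\mathcal{E})$ is a subballean of a ballean $(Z,\mathcal{F})$'', where $X\subseteq Z$, means $\mathcal{E}=\mathcal{F}_X$. A vector ideal on a real vector space $\mathcal{V}$ is a family $\mathcal{I}$ of subsets of $\mathcal{V}$ such that: (1) if $U,U'\in\mathcal{I}$ and $W\subseteq U$ then $U\cup U'\in\mathcal{I}$ and $W\in\mathcal{I}$; (2) if $U\in\mathcal{I}$ then $U+U\in\mathcal{I}$; (3) if $U\in\mathcal{I}$ and $\lambda>0$ then $[-\lambda,\lambda]U=\bigcup\{\lambda'U:\lambda'\in[-\lambda,\lambda]\}\in\mathcal{I}$; (4) $\bigcup\mathcal{I}=\mathcal{V}$. A vector ballean $(\mathcal{V},\mathcal{I})$ is a real vector space $\mathcal{V}$ with a vector ideal $\mathcal{I}$, regarded as a ballean whose coarse structure consists of all $\varepsilon\subseteq\mathcal{V}\times\mathcal{V}$ with $\Delta_{\mathcal{V}}\subseteq\varepsilon\subseteq\{(x,y):x-y\in U\}$ for some $U\in\mathcal{I}$. *)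

(* Defs.v *)
From HB Require Import structures.
From mathcomp Require Import all_boot all_order all_algebra.
From mathcomp Require Import boolp classical_sets set_interval reals.
From mathcomp Require Import freeg.

Set Implicit Arguments.
Unset Strict Implicit.
Unset Printing Implicit Defensive.

Import Order.TTheory GRing.Theory Num.Theory.

Local Open Scope classical_set_scope.
Local Open Scope ring_scope.

(* The family is required to be nonempty.  This follows from [coarse_cover]
   unless X is empty, where it only excludes the empty family.

   In the library's notation, [d \; e] is the set of (x, y) such that
   (x, z) is in e and (z, y) is in d for some z. *)
Record is_coarse_structure (X : Type) (E : set (set (X * X))) : Prop := {
  coarse_nonempty : E !=set0 ;
  coarse_diagonal : forall e, E e -> diagonal `<=` e ;
  coarse_compose : forall e d, E e -> E d -> E (d \; e)%relation ;
  coarse_inverse : forall e, E e -> E (e^-1)%relation ;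
  coarse_subset : forall e e', E e -> diagonal `<=` e' -> e' `<=` e -> E e' ;
  coarse_cover : forall x y : X, exists2 e, E e & e (x, y)
}.

(* [xsection e x] is the ball e[x] = {y | (x, y) in e}. *)
Definition coarse_map (X X' : Type) (E : set (set (X * X)))
    (E' : set (set (X' * X'))) (f : X -> X') : Prop :=
  forall e, E e ->
    exists2 e', E' e' & forall x, f @` xsection e x `<=` xsection e' (f x).

Definition sub_coarse (Z : Type) (Y : set Z) (F : set (set (Z * Z))) :
    set (set (Z * Z)) :=
  [set e `&` (Y `*` Y) | e in F].

(* (X, E) is a subballean of (Z, F), where X is viewed as a subset of Z
   through the injection i. *)
Definition subballean (X Z : Type) (i : X -> Z) (E : set (set (X * X)))
    (F : set (set (Z * Z))) : Prop :=
  injective i /\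
  [set (fun p : X * X => (i p.1, i p.2)) @` e | e in E]
    = sub_coarse (range i) F.

Record is_vector_ideal (R : realType) (V : lmodType R) (I : set (set V)) :
    Prop := {
  videal_setU : forall U U', I U -> I U' -> I (U `|` U') ;
  videal_subset : forall U W, I U -> W `<=` U -> I W ;
  videal_add : forall U, I U -> I [set x + y | x in U & y in U] ;
  videal_scale : forall (U : set V) (l : R), I U -> 0 < l ->
    I [set a *: x | a in `[- l, l] & x in U] ;
  videal_cover : \bigcup_(U in I) U = setT
}.

Definition vector_coarse (R : realType) (V : lmodType R) (I : set (set V)) :
    set (set (V * V)) :=
  [set e | diagonal `<=` e /\
           exists2 U, I U & e `<=` [set p | U (p.1 - p.2)]].

(* The real vector space with basis X: finitely supported formal linear
   combinations of elements of X.  [{classic X}] is X itself, equipped with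
   the choice structure that the free module construction asks for. *)
Definition freevect (R : realType) (X : Type) : lmodType R :=
  {freeg {classic X} / R}.

Definition freevect_basis (R : realType) (X : Type) (x : X) : freevect R X :=
  << (x : {classic X}) >> : {freeg {classic X} / R}.

Definition coarse_linear_extension_property (R : realType) (X : Type)
    (E : set (set (X * X))) (I : set (set (freevect R X))) : Prop :=
  forall (V : lmodType R) (J : set (set V)), is_vector_ideal J ->
  forall f : X -> V, coarse_map E (vector_coarse J) f ->
  exists! g : freevect R X -> V,
    [/\ linear g,
        coarse_map (vector_coarse I) (vector_coarse J) g
      & forall x, g (freevect_basis R x) = f x].

(* Main.v *)
(** The ideal is the intersection of all vector ideals [J] for which the
    inclusion of the basis is coarse.  Pulling [J] back along the linear
    extension of a coarse map [f : X -> (V, J)] gives one of these ideals, whence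
    (ii); applying (ii) to the inclusion of [X] gives uniqueness.  For (i), one
    of these ideals has to be fine enough to restrict to a subfamily of [E].  We
    take the ideal of rank-bounded sets: modulo the span of a fixed finite
    subset of [X], its members consist of combinations, with arbitrary
    coefficients, of at most [n] differences [x - y] with [(x, y)] in a fixed
    [e] in [E].  If [x - y] is a combination of [n] such differences, then [x]
    and [y] are joined by a path with at most [n] edges in [e], since otherwise
    the indicator function of the component of [x] separates them. *)

From HB Require Import structures.
Require Import Defs.
From mathcomp Require Import all_boot all_order all_algebra.
From mathcomp Require Import boolp classical_sets reals.
From mathcomp Require Import freeg.

Set Implicit Arguments.
Unset Strict Implicit.
Unset Printing Implicit Defensive.

Import GRing.Theory.

Local Open Scope classical_set_scope.
Local Open Scope ring_scope.

(** * Composition of entourages *)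

Section CoarseStructure.
Variables (X : Type) (E : set (set (X * X))).
Hypothesis hE : is_coarse_structure E.

Lemma coarse_refl (e : set (X * X)) x : E e -> e (x, x).
Proof. by move=> Ee; apply: (coarse_diagonal hE Ee). Qed.

Lemma mem_composel (e d : set (X * X)) x y :
  E d -> e (x, y) -> (e \; d)%relation (x, y).
Proof. by move=> Ed exy; exists x => //=; exact: coarse_refl. Qed.

Lemma mem_composer (e d : set (X * X)) x y :
  E e -> d (x, y) -> (e \; d)%relation (x, y).
Proof. by move=> Ee dxy; exists y => //=; exact: coarse_refl. Qed.

(** The entourages joining [x] to the separate points are composed; a composite contains both
    factors, as each contains the diagonal. *)
Lemma coarse_cover_seq (x : X) (F : seq {classic X}) :
  exists2 e, E e & forall y, y \in F -> e (x, y).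
Proof.
elim: F => [|z F [e Ee eF]]; first by have [e Ee] := coarse_nonempty hE; exists e.
have [d Ed dxz] := coarse_cover hE x z.
exists (e \; d)%relation => [|y]; first exact: (coarse_compose hE).
rewrite inE => /predU1P[->|yF]; first exact: mem_composer.
by apply: mem_composel => //; exact: eF.
Qed.

End CoarseStructure.

(** * Coarseness expressed through vector ideals *)

Section VectorIdeal.
Variables (R : realType) (V : lmodType R) (J : set (set V)).
Hypothesis hJ : is_vector_ideal J.

Lemma videal_set1 v : J [set v].
Proof.
have : (\bigcup_(U in J) U) v by rewrite (videal_cover hJ).
by move=> [U JU Uv]; apply: (videal_subset hJ JU) => _ ->.
Qed.

Lemma vector_coarse_diff U :
  (* Adjoining 0 puts the diagonal into the relation, as [U] may miss 0. *)
  J U -> vector_coarse J [set p | (U `|` [set 0]) (p.1 - p.2)].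
Proof.
move=> JU; split=> [[x y] /diagonalP ->|]; first by right; rewrite /= subrr.
by exists (U `|` [set 0]) => //; apply: videal_setU => //; exact: videal_set1.
Qed.

Lemma coarse_map_vectorP (X : Type) (E : set (set (X * X))) (f : X -> V) :
  coarse_map E (vector_coarse J) f <->
  (forall e, E e -> J [set f p.1 - f p.2 | p in e]).
Proof.
split=> [fJ e Ee|fJ e Ee].
  have [e' [_ [U JU e'U]] fe] := fJ e Ee.
  apply: (videal_subset hJ JU) => _ [[x y] exy <-]; apply: (e'U (f x, f y)).
  by apply/xsectionP/fe; exists y => //; apply/xsectionP.
exists [set p | ([set f p.1 - f p.2 | p in e] `|` [set 0]) (p.1 - p.2)].
  by apply: vector_coarse_diff; exact: fJ.
move=> x _ [y /xsectionP exy <-]; apply/xsectionP; left.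
by exists (x, y).
Qed.

End VectorIdeal.

(** Since [g x - g y = g (x - y)], differences over an entourage are images of members of [I];
    conversely [u] is the difference of the pair [(u, 0)]. *)
Lemma coarse_map_linearP (R : realType) (V W : lmodType R) (I : set (set V))
    (J : set (set W)) (hI : is_vector_ideal I) (hJ : is_vector_ideal J)
    (g : {linear V -> W}) :
  coarse_map (vector_coarse I) (vector_coarse J) g <->
  (forall U, I U -> J (g @` U)).
Proof.
rewrite coarse_map_vectorP //; split=> [gJ U IU|gJ e [_ [U IU eU]]].
  apply: (videal_subset hJ (gJ _ (vector_coarse_diff hI IU))) => _ [u Uu <-].
  by exists (u, 0); [left; rewrite /= subr0|rewrite /= linear0 subr0].
apply: (videal_subset hJ (gJ U IU)) => _ [[x y] exy <-].
by exists (x - y); [exact: (eU (x, y))|rewrite /= linearB].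
Qed.

Lemma is_vector_ideal_preimage (R : realType) (V W : lmodType R)
    (J : set (set W)) (hJ : is_vector_ideal J) (g : {linear V -> W}) :
  is_vector_ideal [set U : set V | J (g @` U)].
Proof.
split=> /=.
- by move=> U U' JU JU'; rewrite image_setU; exact: videal_setU.
- by move=> U W' JU W'U; apply: (videal_subset hJ JU); exact: image_subset.
- move=> U JU; apply: (videal_subset hJ (videal_add hJ JU)).
  move=> _ [_ [x Ux [y Uy <-]] <-]; rewrite linearD.
  by exists (g x); [exists x|exists (g y); [exists y|]].
- move=> U l JU l0; apply: (videal_subset hJ (videal_scale hJ JU l0)).
  move=> _ [_ [a al [x Ux <-]] <-]; rewrite linearZ.
  by exists a => //; exists (g x) => //; exists x.
- apply/seteqP; split=> // v _; exists [set v] => //=.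
  by rewrite image_set1; exact: videal_set1.
Qed.

(** * Linear maps out of the free vector space *)

Section FreeVectorSpace.
Variables (R : realType) (X : Type).
Local Notation basis := (@freevect_basis R X).

Lemma freevect_sumE (u : freevect R X) :
  u = \sum_(x <- dom (u : {freeg {classic X} / R})) coeff x u *: basis x.
Proof.
rewrite -[LHS]freeg_sumE; apply: eq_bigr => x _.
by apply/eqP/freeg_eqP => y; rewrite coeffZ !coeffU mul1r.
Qed.

Lemma freevect_linear_ext (V : lmodType R) (g h : {linear freevect R X -> V}) :
  (forall x, g (basis x) = h (basis x)) -> g =1 h.
Proof.
move=> gh u; rewrite [u]freevect_sumE !linear_sum; apply: eq_bigr => x _.
by rewrite !linearZ /= gh.
Qed.

Section Lift.
Variables (V : lmodType R) (f : X -> V).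

Definition freevect_lift (u : freevect R X) : V :=
  fglift (f : {classic X} -> V) u.

Lemma freevect_lift_basis x : freevect_lift (basis x) = f x.
Proof. by rewrite /freevect_lift liftU scale1r. Qed.

Lemma freevect_lift_is_linear : linear freevect_lift.
Proof.
pose lift : {additive freevect R X -> V} := HB.pack freevect_lift
  (GRing.isZmodMorphism.Build (freevect R X) V freevect_lift
    (lift_is_additive (f : {classic X} -> V))).
move=> a u v; rewrite -[freevect_lift]/(lift : _ -> _) raddfD /=; congr (_ + _).
(* Scaling is a sum over the support, so additivity reduces the claim to single terms. *)
rewrite -[u in RHS]freeg_sumE -[a *: u]/(fgscale a u) /fgscale.
rewrite -[freevect_lift]/(lift : _ -> _) !raddf_sum; apply: eq_bigr => x _.
by rewrite /= /freevect_lift !liftU scalerA.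
Qed.

HB.instance Definition _ := GRing.isLinear.Build R (freevect R X) V _ freevect_lift
  freevect_lift_is_linear.

End Lift.

Lemma freevect_basis_inj : injective basis.
Proof.
move=> x y /(congr1 (coeff (x : {classic X}))); rewrite !coeffU eqxx !mul1r.
by case: eqP => // _ /eqP; rewrite oner_eq0.
Qed.

End FreeVectorSpace.

(** * Graph components and rank-bounded sets *)

Section Linked.
Variables (R : realType) (X : Type).
Local Notation edges := (seq ({classic X} * {classic X})).

Definition invariant_on (l : edges) (phi : X -> R^o) :=
  forall p, p \in l -> phi p.1 = phi p.2.

(* The dual description of "[x] and [y] lie in the same component of the graph
   with edges [l]". *)
Definition linked (l : edges) (x y : X) :=
  forall phi, invariant_on l phi -> phi x = phi y.

Lemma linked_trans l x y z : linked l x y -> linked l y z -> linked l x z.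
Proof. by move=> xy yz phi hphi; rewrite xy ?yz. Qed.

Lemma linked_sym l x y : linked l x y -> linked l y x.
Proof. by move=> xy phi hphi; rewrite xy. Qed.

(** The indicator function of [S] is invariant on [l]. *)
Lemma linked_set (l : edges) x y (S : set X) :
  (forall p, p \in l -> S p.1 <-> S p.2) -> linked l x y -> S x -> S y.
Proof.
move=> hS /(_ (fun z => `[< S z >]%:R)) xy Sx.
have /xy : invariant_on l (fun z => `[< S z >]%:R).
  by move=> p /hS pS /=; congr (_%:R); congr nat_of_bool; exact: asbool_equiv_eq.
rewrite asboolT //; case: asboolP => // _ /eqP.
by rewrite oner_eq0.
Qed.

(** The points [y] satisfying the conclusion form a set that contains [x] and respects every edge,
    the new one included. *)
Lemma linked_cons a b (l : edges) x y : linked ((a, b) :: l) x y ->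
  linked l x y \/
  (linked l x a \/ linked l x b) /\ (linked l a y \/ linked l b y).
Proof.
pose S z := linked l x z \/
  (linked l x a \/ linked l x b) /\ (linked l a z \/ linked l b z).
move=> xy; apply: (linked_set (S := S) _ xy); last by left.
have invS p q : linked l p q -> S p -> S q.
  move=> pq [xp|[xab [ap|bp]]]; first by left; exact: linked_trans pq.
    by right; split=> //; left; exact: linked_trans pq.
  by right; split=> //; right; exact: linked_trans pq.
move=> p; rewrite inE => /predU1P[->|pl] /=.
  by split=> [[?|[? _]]|[?|[? _]]]; right; split; auto;
    [right|right|left|left].
have p12 : linked l p.1 p.2 by move=> phi; apply.
by split; apply: invS => //; exact: linked_sym.
Qed.

Variable E : set (set (X * X)).
Hypothesis hE : is_coarse_structure E.

(** Induction on the number of edges: a path through one more edge is a path in the old edges, a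
    step along the new edge, and another old path. *)
Lemma linked_bounded e n : E e ->
  exists2 d, E d & forall l : edges, (size l <= n)%N ->
    {in l, forall p, e p} -> forall x y, linked l x y -> d (x, y).
Proof.
move=> Ee; elim: n => [|n [d Ed dn]].
  (* Without edges the singleton of [x] is invariant, so [y] equals [x]. *)
  exists e => // -[]// _ _ x y /linked_set/(_ (erefl x)) <- //.
  exact: (coarse_refl hE).
pose s := (e \; e^-1)%relation.
have Es : E s by apply: (coarse_compose hE) => //; exact: (coarse_inverse hE).
have es x y : e (x, y) -> s (x, y).
  by apply: (mem_composel hE); exact: (coarse_inverse hE).
have es' x y : e (y, x) -> s (x, y) by apply: (mem_composer hE).
have Eds : E (d \; s)%relation by exact: (coarse_compose hE Es Ed).
exists ((d \; s) \; d)%relation; first exact: (coarse_compose hE Ed Eds).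
move=> [|[a b] l] /= ln el x y.
  by move=> xy; apply: (mem_composer hE Eds); exact: (dn [::]).
have eab : e (a, b) by apply: el; rewrite inE eqxx.
have {}dn : forall x y, linked l x y -> d (x, y).
  by apply: dn => // p pl; apply: el; rewrite inE pl orbT.
case/linked_cons => [/dn xy|[xab aby]]; first exact: (mem_composer hE Eds).
(* [p] and [q] are ends of the new edge, possibly equal or in reverse order; [s] covers all these
   cases. *)
suff [p [q [xp pq qy]]] : exists p q, [/\ linked l x p, s (p, q) & linked l q y].
  by exists p; [exact: dn|exists q => //; exact: dn].
case: xab => xp; case: aby => qy.
- by exists a, a; split=> //; exact: (coarse_refl hE).
- by exists a, b; split=> //; exact: es.
- by exists b, a; split=> //; exact: es'.
- by exists b, b; split=> //; exact: (coarse_refl hE).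
Qed.

(* The condition on [u] is dual to: [u] lies in the span of [F] and of the
   differences [p.1 - p.2] for [p] in [l]. *)
Definition rank_ideal : set (set (freevect R X)) :=
  [set U | exists e n (F : seq {classic X}), E e /\ forall u, U u ->
    exists l : edges, [/\ (size l <= n)%N, {in l, forall p, e p} &
      forall phi, invariant_on l phi -> (forall x, x \in F -> phi x = 0) ->
        freevect_lift phi u = 0]].

(** Sums concatenate edge lists, and scaling keeps them because coefficients are unrestricted. A
    single vector needs no edges once [F] is its support. *)
Lemma rank_ideal_is_vector_ideal : is_vector_ideal rank_ideal.
Proof.
split.
- move=> U U' [e [n [F [Ee Ue]]]] [e' [n' [F' [Ee' Ue']]]].
  exists (e \; e')%relation, (maxn n n'), (F ++ F').
  split=> [|u]; first exact: (coarse_compose hE).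
  case=> [/Ue|/Ue'] [l [ln le lu]]; exists l; split=> [||phi hphi phi0].
  + by rewrite leq_max ln.
  + by move=> [x y] /le; exact: (mem_composel hE).
  + by apply: lu => // x xF; apply: phi0; rewrite mem_cat xF.
  + by rewrite leq_max ln orbT.
  + by move=> [x y] /le; exact: (mem_composer hE).
  + by apply: lu => // x xF; apply: phi0; rewrite mem_cat xF orbT.
- move=> U W [e [n [F [Ee Ue]]]] WU; exists e, n, F; split=> // u /WU.
  exact: Ue.
- move=> U [e [n [F [Ee Ue]]]]; exists e, (n + n)%N, F; split=> // _ [u Uu [v Uv <-]].
  have [l [ln le lu]] := Ue _ Uu; have [m [mn me mv]] := Ue _ Uv.
  exists (l ++ m); split=> [|p|phi hphi phi0].
  + by rewrite size_cat leq_add.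
  + by rewrite mem_cat => /orP[/le|/me].
  + rewrite linearD /= lu ?mv ?addr0// => p pl; apply: hphi;
      by rewrite mem_cat pl ?orbT.
- move=> U r [e [n [F [Ee Ue]]]] _; exists e, n, F; split=> // _ [a _ [u Uu <-]].
  have [l [ln le lu]] := Ue _ Uu; exists l; split=> // phi hphi phi0.
  by rewrite linearZ /= lu // scaler0.
- apply/seteqP; split=> // u _; exists [set u] => //.
  have [e Ee] := coarse_nonempty hE.
  exists e, 0%N, (dom (u : {freeg {classic X} / R})); split=> // _ ->.
  exists [::]; split=> // phi _ phi0.
  rewrite [u in freevect_lift _ u]freevect_sumE linear_sum big_seq big1 // => x xu.
  by rewrite linearZ /= freevect_lift_basis phi0 // scaler0.
Qed.

Lemma rank_ideal_coarse_basis :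
  coarse_map E (vector_coarse rank_ideal) (@freevect_basis R X).
Proof.
apply/(coarse_map_vectorP rank_ideal_is_vector_ideal) => e Ee.
exists e, 1%N, [::]; split=> // _ [[x y] exy <-].
exists [:: (x : {classic X}, y : {classic X})]; split=> // [p|phi hphi _].
  by rewrite inE => /eqP ->.
rewrite linearB /= !freevect_lift_basis; apply/eqP; rewrite subr_eq0; apply/eqP.
by apply: (hphi (x, y)); rewrite inE.
Qed.

(** The vanishing condition on a nonempty finite set is traded for edges from one of its points [z]
    to the others, which bounds the path length again. *)
Lemma rank_ideal_diff_bounded U : rank_ideal U ->
  exists2 d, E d &
    forall x y, U (freevect_basis R x - freevect_basis R y) -> d (x, y).
Proof.
move=> [e [n [[|z F] [Ee Ue]]]].
  have [d Ed dn] := linked_bounded n Ee; exists d => // x y /Ue[l [ln le lu]].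
  apply: (dn l) => // phi hphi.
  have : freevect_lift phi (freevect_basis R x - freevect_basis R y) = 0.
    exact: lu.
  by rewrite linearB /= !freevect_lift_basis => /eqP; rewrite subr_eq0 => /eqP.
have [e' Ee' e'F] := coarse_cover_seq hE z F.
have [d Ed dn] := linked_bounded (n + size F) (coarse_compose hE Ee Ee').
exists d => // x y /Ue[l [ln le lu]].
pose m : edges := [seq (z, f) | f <- F].
apply: (dn (l ++ m)) => [|[a b]|phi hphi].
- by rewrite size_cat size_map leq_add2r.
- rewrite mem_cat => /orP[/le|/mapP[f fF [-> ->]]]; first exact: (mem_composer hE).
  by apply: (mem_composel hE) => //; exact: e'F.
(* [phi] is constant on the finite set; subtracting that constant makes it vanish there and leaves
   [phi x - phi y] unchanged. *)
- pose psi t : R^o := phi t - phi z.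
  have psi0 : freevect_lift psi (freevect_basis R x - freevect_basis R y) = 0.
    apply: lu => [p pl|f]; first by rewrite /psi hphi // mem_cat pl.
    rewrite inE => /predU1P[->|fF]; first by rewrite /psi subrr.
    rewrite /psi -(hphi (z, f)) ?subrr// mem_cat.
    by rewrite [X in _ || X](map_f (fun f => (z, f))) ?orbT.
  move: psi0; rewrite linearB /= !freevect_lift_basis /psi => /eqP.
  by rewrite opprB addrA subrK subr_eq0 => /eqP.
Qed.

End Linked.

(** * The least ideal: restriction to the basis and extension property *)

Section LeastIdeal.
Variables (R : realType) (X : Type) (E : set (set (X * X))).
Hypothesis hE : is_coarse_structure E.
Local Notation basis := (@freevect_basis R X).

Definition least_ideal : set (set (freevect R X)) :=
  [set U | forall J, is_vector_ideal J ->
    coarse_map E (vector_coarse J) basis -> J U].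

Lemma least_ideal_is_vector_ideal : is_vector_ideal least_ideal.
Proof.
split.
- move=> U U' IU IU' J hJ bJ.
  by apply: videal_setU => //; [exact: IU|exact: IU'].
- by move=> U W IU WU J hJ bJ; apply: (videal_subset hJ _ WU); exact: IU.
- by move=> U IU J hJ bJ; apply: videal_add => //; exact: IU.
- by move=> U r IU r0 J hJ bJ; apply: videal_scale => //; exact: IU.
- apply/seteqP; split=> // u _; exists [set u] => // J hJ _.
  exact: videal_set1.
Qed.

Lemma least_ideal_coarse_basis : coarse_map E (vector_coarse least_ideal) basis.
Proof.
apply/(coarse_map_vectorP least_ideal_is_vector_ideal) => e Ee J hJ.
by move/(coarse_map_vectorP hJ); apply.
Qed.

Lemma least_ideal_subballean : subballean basis E (vector_coarse least_ideal).
Proof.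
split; first exact: freevect_basis_inj.
apply/seteqP; split=> [_ [e Ee <-]|_ [e [ediag [U IU eU]] <-]].
  have [e' [e'diag [U IU e'U]] be'] := least_ideal_coarse_basis Ee.
  pose ie := (fun p : X * X => (basis p.1, basis p.2)) @` e.
  (* The added diagonal makes this an entourage; on the basis it only contributes pairs already in
     [ie]. *)
  exists (diagonal `|` ie).
    split; first by move=> p; left.
    exists U => // -[u v] [/diagonalP ->|[[x y] exy [<- <-]]].
      by apply: (e'U (v, v)); exact: e'diag.
    apply: e'U; apply/xsectionP/be'; exists y => //; exact/xsectionP.
  apply/seteqP; split=> [[u v] [[/diagonalP ->|//] /= [_ [x _ <-]]]|].
    by exists (x, x) => //; exact: (coarse_refl hE).
  by move=> _ [[x y] exy <-]; split; [right; exists (x, y)|split; [exists x|exists y]].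
(* The rank ideal is one of the ideals intersected, so it contains [U]. *)
have [d Ed dU] := rank_ideal_diff_bounded hE
  (IU _ (rank_ideal_is_vector_ideal R hE) (rank_ideal_coarse_basis R hE)).
exists [set p | e (basis p.1, basis p.2)].
  apply: (coarse_subset hE Ed) => [[x y] /diagonalP ->|[x y] /eU exy].
    exact: ediag.
  exact: dU.
apply/seteqP; split=> [_ [[x y] exy <-]|[u v] [exy /= [[x _ xu] [y _ yv]]]].
  by split.
by exists (x, y); rewrite /= xu yv.
Qed.

Lemma least_ideal_extension : coarse_linear_extension_property E least_ideal.
Proof.
move=> V J hJ f fJ; exists (freevect_lift f); split.
  split=> [||x]; [exact: freevect_lift_is_linear| |exact: freevect_lift_basis].
  apply/(coarse_map_linearP least_ideal_is_vector_ideal hJ (freevect_lift f)).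
  (* [U] lies in the pulled-back ideal as soon as the basis inclusion is coarse for it, which is the
     coarseness of [f]. *)
  move=> U /(_ _ (is_vector_ideal_preimage hJ (freevect_lift f))); apply.
  apply/(coarse_map_vectorP (is_vector_ideal_preimage hJ (freevect_lift f))).
  move=> e Ee; move/(coarse_map_vectorP hJ)/(_ e Ee): fJ => fJe.
  apply: (videal_subset hJ fJe) => _ [_ [p ep <-] <-].
  by exists p => //; rewrite linearB /= !freevect_lift_basis.
move=> g [glin _ gf]; apply/funext.
pose g' : {linear freevect R X -> V} :=
  HB.pack g (GRing.isLinear.Build R (freevect R X) V _ g glin).
apply: (freevect_linear_ext (g := freevect_lift f) (h := g')) => x.
by rewrite /= freevect_lift_basis gf.
Qed.

(** The linear extension of the basis inclusion is the identity, and its coarseness from [I] to [J]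
    says that [I] is contained in [J]. *)
Lemma extension_property_subset (I J : set (set (freevect R X))) :
  is_vector_ideal I -> coarse_linear_extension_property E I ->
  is_vector_ideal J -> coarse_map E (vector_coarse J) basis -> I `<=` J.
Proof.
move=> hI extI hJ bJ; have [g [[glin gco gb] _]] := extI _ _ hJ _ bJ.
pose g' : {linear freevect R X -> freevect R X} :=
  HB.pack g (GRing.isLinear.Build R (freevect R X) (freevect R X) _ g glin).
have gid : g' = id :> (freevect R X -> freevect R X).
  exact/funext/(freevect_linear_ext (h := idfun)).
move/(coarse_map_linearP hI hJ g'): gco => gJ U /gJ.
by rewrite gid image_id.
Qed.

End LeastIdeal.

(** Makes any ideal satisfying (i) one of those intersected in [least_ideal], which gives one
    inclusion of the uniqueness proof. *)
Lemma subballean_coarse_map (X Z : Type) (i : X -> Z) (E : set (set (X * X)))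
    (F : set (set (Z * Z))) : subballean i E F -> coarse_map E F i.
Proof.
move=> [_ EF] e Ee.
have : sub_coarse (range i) F ((fun p => (i p.1, i p.2)) @` e).
  by rewrite -EF; exists e.
move=> [e' Fe' ee']; exists e' => // x _ [y /xsectionP exy <-]; apply/xsectionP.
suff [] : (e' `&` (range i `*` range i)) (i x, i y) by [].
by rewrite ee'; exists (x, y).
Qed.

Theorem mainTheorem1 (R : realType) (X : Type) (E : set (set (X * X)))
    (hE : is_coarse_structure E) :
  exists! I : set (set (freevect R X)),
    [/\ is_vector_ideal I,
        subballean (freevect_basis R (X := X)) E (vector_coarse I)
      & coarse_linear_extension_property E I].
Proof.
have hL := least_ideal_is_vector_ideal R E.
have bL := @least_ideal_coarse_basis R X E.
exists (least_ideal E); split.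
  split=> //; [exact: least_ideal_subballean|exact: least_ideal_extension].
move=> I [hI /subballean_coarse_map bI extI]; apply/seteqP; split.
  by move=> U; apply.
exact: extension_property_subset extI hL bL.
Qed.
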